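(* Let $a_0,a_1,a_2$ be complex constants, let $b$ be a complex constant, let $p(z)$ and $h(z)$ be analytic functions in a neighborhood of the origin, and let the complex number $\gamma$ satisfy $0<|\gamma|<1$. Let $\eta$ be a nonzero complex number. Then the auxiliary equation \begin{align*} a_2 \gamma^{2} g''(\gamma z) g'(z) &= [g(\gamma^2 z) - p(g(\gamma z))]\,\gamma g'(\gamma z)(g'(z))^{2} + b h'(g(z))(g'(z))^{3}\\ &\quad + \Big(a_2p''(g(z)) + a_1p'(g(z)) + a_0p(g(z))\Big)(g'(z))^{3}\\ &\quad - a_1\gamma g'(\gamma z)(g'(z))^{2} - a_0 g(\gamma z)(g'(z))^{3} + a_2\gamma g'(\gamma z)g''(z) \end{align*} has an analytic solution $g(z)=\sum_{n=1}^{\infty} c_n z^n$ in a neighborhood of the origin such that $g(0)=0$ and $g'(0)=\eta$.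
   Context: Primes denote derivatives with respect to the complex argument; for example, $g''(\gamma z)$ is $g''$ evaluated at $\gamma z$, and $p''(g(z))$ is $p''$ evaluated at $g(z)$.
   Formalization: The formal statement adds the assumption that a_2 is nonzero; with a_2 = 0 the claim fails, e.g. a_0 = a_1 = a_2 = 0, b = 1, p = 0, h(z) = z, η = 1, γ = 1/2 makes the equation at z = 0 read 0 = 1. *)

(* Defs.v *)
From Stdlib Require Import Reals.
From Coquelicot Require Import Coquelicot.

Open Scope C_scope.

(* [is_pseries c z (f z)] is taken in [C] as a normed module over itself, so the
   series converges in the complex plane. *)
Definition has_expansion (f : C -> C) (c : nat -> C) : Prop :=
  locally (RtoC 0) (fun z : C => is_pseries c z (f z)).

(* Only the values of [f] near 0 matter; away from 0 the total function [f] is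
   arbitrary. *)
Definition analytic_near_origin (f : C -> C) : Prop :=
  exists c : nat -> C, has_expansion f c.

(* [C_derive f z] is computed as a limit along the real direction; it is the
   complex derivative wherever [f] is complex differentiable
   ([is_C_derive_unique]), in particular near 0 for the functions used here. *)
Definition auxiliary_equation
    (a0 a1 a2 b gamma : C) (p h g : C -> C) (z : C) : Prop :=
  let p' := C_derive p in
  let p'' := C_derive p' in
  let h' := C_derive h in
  let g' := C_derive g in
  let g'' := C_derive g' in
  a2 * gamma ^ 2 * g'' (gamma * z) * g' z =
    (g (gamma ^ 2 * z) - p (g (gamma * z))) * gamma * g' (gamma * z) * g' z ^ 2
    + b * h' (g z) * g' z ^ 3
    + (a2 * p'' (g z) + a1 * p' (g z) + a0 * p (g z)) * g' z ^ 3
    - a1 * gamma * g' (gamma * z) * g' z ^ 2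
    - a0 * g (gamma * z) * g' z ^ 3
    + a2 * gamma * g' (gamma * z) * g'' z.

(* Main.v *)
(* After division by [(g' z)^2] the terms with [a2] become the derivative of
   [a2 gamma g'(gamma z) / g' z], so integrating from [0] turns the equation into
   [a2 gamma (g'(gamma z) - g' z) = g' z * int_0^z F], where [F] is built from [g], [g'],
   [p], [h] without second derivatives of [g].  Comparing coefficients,
   [a2 gamma (gamma^n - 1)] times the [n]-th coefficient of [g'] is determined by the
   previous ones, so [g'] is the fixed point of a causal map on sequences.  As
   [|gamma^n - 1| >= 1 - |gamma|] and the two integrations [g = int g'] and [int F] gain
   a factor [r] each in the norm [sum |w_n| r^n], this map preserves the ball of radius
   [2 |eta|] for [r] small, which gives convergence. *)

Require Import Defs.
From Stdlib Require Import Reals Lra Lia.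
From Coquelicot Require Import Coquelicot.
Local Open Scope C_scope.

(** * Coefficient sequences: weighted norm, products and composition *)

(** The norm [sum |a n| r^n] is bounded through its partial sums, so no limit has to be formed
    before its existence is known. *)
Definition ell1_bound (r M : R) (a : nat -> C) : Prop :=
  forall N : nat, (sum_n (fun n => Cmod (a n) * r ^ n)%R N <= M)%R.

Definition pseries_sum (a : nat -> C) (z : C) : C :=
  iota (T := C_CompleteNormedModule) (fun l : C => is_pseries a z l).

(* Both Cauchy products and compositions are superpositions of sequences [u k] starting
   at index [k]: shifts of one factor, respectively powers of the inner series. *)
Definition superpose (u : nat -> nat -> C) (n : nat) : C :=
  sum_n (fun k => u k n) n.

Definition cauchy_prod (a b : nat -> C) (n : nat) : C :=
  sum_n (fun k => a k * b (n - k)%nat) n.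

Definition const_seq (c : C) (n : nat) : C :=
  match n with O => c | S _ => RtoC 0 end.

Fixpoint cauchy_pow (a : nat -> C) (k : nat) : nat -> C :=
  match k with
  | O => const_seq (RtoC 1)
  | S k => cauchy_prod a (cauchy_pow a k)
  end.

(** [superpose] stops at [k = n]; when [a 0] vanishes this loses nothing, because the [k]-th power
    of [a] then starts at index [k]. *)
Definition compose_seq (q a : nat -> C) : nat -> C :=
  superpose (fun k n => (q k * cauchy_pow a k n)%C).

(** * Normed algebra of power series *)

Lemma sum_n_extend {G : AbelianMonoid} (u : nat -> G) (n N : nat) :
  (n <= N)%nat -> (forall k, (n < k)%nat -> u k = zero) ->
  sum_n u N = sum_n u n.
Proof.
intros HnN Hu; induction HnN as [|N HnN IH]; [reflexivity|].
rewrite sum_Sn, IH, Hu by lia; apply plus_zero_r.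
Qed.

Lemma sum_n_shift {G : AbelianMonoid} (u : nat -> G) (K N : nat) :
  sum_n u (S K + N) = plus (sum_n u K) (sum_n (fun k => u (S K + k)%nat) N).
Proof.
induction N as [|N IH].
- rewrite sum_O, Nat.add_0_r, sum_Sn; reflexivity.
- rewrite <- plus_n_Sm, !sum_Sn, IH, <- plus_assoc; do 3 f_equal; lia.
Qed.

Lemma Cmod_sum_n (a : nat -> C) (N : nat) :
  (Cmod (sum_n a N) <= sum_n (fun n => Cmod (a n)) N)%R.
Proof. exact (norm_sum_n_m a 0 N). Qed.

Lemma sum_n_le_loc (a b : nat -> R) (N : nat) :
  (forall n, (n <= N)%nat -> (a n <= b n)%R) -> (sum_n a N <= sum_n b N)%R.
Proof.
intros H; induction N as [|N IH].
- rewrite !sum_O; apply H; lia.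
- rewrite !sum_Sn; apply Rplus_le_compat; [apply IH; intros; apply H; lia|apply H; lia].
Qed.

Lemma ell1_bound_nonneg (r M : R) (a : nat -> C) : ell1_bound r M a -> (0 <= M)%R.
Proof.
intros H; specialize (H 0%nat); rewrite sum_O in H; simpl in H.
pose proof (Cmod_ge_0 (a 0%nat)); lra.
Qed.

Lemma ell1_bound_ext (r M : R) (a b : nat -> C) :
  (forall n, a n = b n) -> ell1_bound r M a -> ell1_bound r M b.
Proof.
intros E H N; specialize (H N).
rewrite (sum_n_ext _ (fun n => Cmod (a n) * r ^ n)%R); [exact H|].
now intros n; rewrite E.
Qed.

Lemma ex_series_bounded (m : nat -> R) (M : R) :
  (forall k, (0 <= m k)%R) -> (forall K, (sum_n m K <= M)%R) -> ex_series m.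
Proof.
intros Hm HM.
destruct (ex_finite_lim_seq_incr (sum_n m) M) as [l Hl].
- intros n; rewrite sum_Sn; unfold plus; simpl; specialize (Hm (S n)); lra.
- exact HM.
- exists l; exact Hl.
Qed.

Lemma pow_n_Cpow (z : C) (n : nat) : pow_n z n = z ^ n.
Proof. induction n as [|n IH]; [reflexivity|simpl; now rewrite IH]. Qed.

Lemma pseries_term_le (r : R) (a : nat -> C) (z : C) (n : nat) :
  (Cmod z <= r)%R -> (Cmod (scal (pow_n z n) (a n)) <= Cmod (a n) * r ^ n)%R.
Proof.
intros Hz; change (scal (pow_n z n) (a n)) with (pow_n z n * a n).
rewrite pow_n_Cpow, Cmod_mult, Cmod_pow, Rmult_comm.
apply Rmult_le_compat_l; [apply Cmod_ge_0|].
apply pow_incr; split; [apply Cmod_ge_0|exact Hz].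
Qed.

Lemma is_series_C_unique (a : nat -> C) (l l' : C) :
  is_series a l -> is_series a l' -> l = l'.
Proof. intros H H'; exact (filterlim_locally_unique _ _ _ H H'). Qed.

Lemma pseries_sum_unique (a : nat -> C) (z l : C) :
  is_pseries a z l -> pseries_sum a z = l.
Proof.
intros H; apply (iota_unique (K := C_AbsRing) (V := C_CompleteNormedModule)); [|exact H].
intros y Hy; exact (is_series_C_unique _ _ _ Hy H).
Qed.

Lemma pseries_sum_correct (r M : R) (a : nat -> C) (z : C) :
  (Cmod z <= r)%R -> ell1_bound r M a -> is_pseries a z (pseries_sum a z).
Proof.
intros Hz Ha.
destruct (ex_series_le (V := C_CompleteNormedModule)
  (fun n => scal (pow_n z n) (a n)) (fun n => Cmod (a n) * r ^ n)%R) as [l Hl].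
- intros n; exact (pseries_term_le r a z n Hz).
- apply ex_series_bounded with (2 := Ha); intros k.
  apply Rmult_le_pos; [apply Cmod_ge_0|apply pow_le].
  apply Rle_trans with (2 := Hz), Cmod_ge_0.
- rewrite (pseries_sum_unique a z l Hl); exact Hl.
Qed.

Lemma is_series_Cmod_le (u : nat -> C) (M : R) (l : C) :
  (forall N, (sum_n (fun n => Cmod (u n)) N <= M)%R) ->
  is_series u l -> (Cmod l <= M)%R.
Proof.
intros HM Hl.
assert (L : is_lim_seq (fun N => Cmod (sum_n u N)) (Cmod l))
  by exact (filterlim_comp _ _ _ _ _ _ _ _ Hl
              (filterlim_norm (K := C_AbsRing) (V := C_NormedModule) l)).
refine (is_lim_seq_le _ _ (Finite (Cmod l)) (Finite M) _ L (is_lim_seq_const M)).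
intros N; exact (Rle_trans _ _ _ (Cmod_sum_n u N) (HM N)).
Qed.

Lemma is_pseries_Cmod_le (r M : R) (a : nat -> C) (z l : C) :
  (Cmod z <= r)%R -> ell1_bound r M a -> is_pseries a z l -> (Cmod l <= M)%R.
Proof.
intros Hz Ha; apply is_series_Cmod_le; intros N; refine (Rle_trans _ _ _ _ (Ha N)).
apply sum_n_le_loc; intros n _; now apply pseries_term_le.
Qed.

(** Since [u k n] vanishes for [n < k], the triangular sum over [k <= n <= N] extends to the full
    square, where the two finite sums can be exchanged. *)
Lemma ell1_bound_superpose (r M : R) (m : nat -> R) (u : nat -> nat -> C) :
  (0 <= r)%R ->
  (forall k n, (n < k)%nat -> u k n = RtoC 0) ->
  (forall k, ell1_bound r (m k) (u k)) ->
  (forall K, (sum_n m K <= M)%R) ->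
  ell1_bound r M (superpose u).
Proof.
intros Hr Hu Hm HM N.
apply Rle_trans with (sum_n (fun n => sum_n (fun k => Cmod (u k n) * r ^ n)%R N) N).
- apply sum_n_le_loc; intros n Hn.
  unfold superpose; rewrite <- (sum_n_extend (fun k => u k n) n N Hn (fun k => Hu k n)).
  refine (Rle_trans _ (_ * _)%R _ (Rmult_le_compat_r _ _ _ (pow_le _ _ Hr) (Cmod_sum_n _ _)) _).
  right; symmetry; exact (sum_n_mult_r (K := R_Ring) (r ^ n)%R (fun k => Cmod (u k n)) N).
- rewrite sum_n_switch; eapply Rle_trans; [|exact (HM N)].
  apply sum_n_le_loc; intros k _; exact (Hm k N).
Qed.

(** This replaces a theorem on double series: the remainder after the terms [U 0, ..., U K] is
    itself the value of the superposition of the tail [u (S K + k)], so its modulus is at most the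
    tail of the series of [m]. *)
Lemma is_series_superpose (r M : R) (m : nat -> R) (u : nat -> nat -> C) (z : C)
    (U : nat -> C) :
  (Cmod z <= r)%R ->
  (forall k n, (n < k)%nat -> u k n = RtoC 0) ->
  (forall k, ell1_bound r (m k) (u k)) ->
  (forall K, (sum_n m K <= M)%R) ->
  (forall k, is_pseries (u k) z (U k)) ->
  is_series U (pseries_sum (superpose u) z).
Proof.
intros Hz Hu Hm HM HU.
assert (Hr : (0 <= r)%R) by (apply Rle_trans with (2 := Hz), Cmod_ge_0).
assert (Pm : forall k, (0 <= m k)%R) by (intros k; exact (ell1_bound_nonneg _ _ _ (Hm k))).
(* [M] is only an upper bound; the remainder estimate needs the exact sum [L], so that
   [L - sum_n m K] tends to 0. *)
destruct (ex_series_bounded m M Pm HM) as [L HL].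
assert (LeL : forall K, (sum_n m K <= L)%R).
{ intros K; apply (is_lim_seq_incr_compare (sum_n m) L HL).
  intros n; rewrite sum_Sn; unfold plus; simpl; specialize (Pm (S n)); lra. }
set (T := pseries_sum (superpose u) z).
assert (HT : is_pseries (superpose u) z T).
{ apply (pseries_sum_correct r M); [exact Hz|].
  now apply ell1_bound_superpose with (m := m). }
assert (HS : forall K, is_pseries (fun n => sum_n (fun k => u k n) K) z (sum_n U K)).
{ induction K as [|K IH].
  - rewrite sum_O; apply is_pseries_ext with (2 := HU 0%nat); intros n; now rewrite sum_O.
  - rewrite sum_Sn; refine (is_pseries_ext _ _ _ _ _ (is_pseries_plus _ _ _ _ _ IH (HU (S K)))).
    intros n; unfold PS_plus; now rewrite sum_Sn. }
assert (HK : forall K, (Cmod (T - sum_n U K) <= L - sum_n m K)%R).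
{ intros K; refine (is_pseries_Cmod_le r _ _ z _ Hz _ (is_pseries_minus _ _ _ _ _ HT (HS K))).
  apply (ell1_bound_ext _ _ (superpose (fun k => u (S K + k)%nat))).
  - intros n; unfold PS_minus, PS_plus, PS_opp, superpose.
    rewrite <- (sum_n_extend (fun k => u k n) n (S K + n)) by (try lia; intros; now apply Hu).
    rewrite sum_n_shift, plus_comm, plus_assoc.
    rewrite (plus_opp_l (G := C_AbelianGroup)); symmetry; apply plus_zero_l.
  - apply ell1_bound_superpose with (m := fun k => m (S K + k)%nat); auto.
    + intros k n Hk; apply Hu; lia.
    + intros N; pose proof (sum_n_shift m K N) as E; unfold plus in E; simpl in E.
      specialize (LeL (S K + N)%nat); simpl in LeL |- *; lra. }
apply (filterlim_locally_ball_norm (K := C_AbsRing) (U := C_NormedModule)); intros eps.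
pose proof (proj1 (filterlim_locally (sum_n m) L) HL eps) as [K0 HK0].
exists K0; intros K Hle; specialize (HK0 K Hle); specialize (HK K).
unfold ball_norm; change (Cmod (sum_n U K - T) < eps)%R.
replace (sum_n U K - T) with (- (T - sum_n U K)) by ring; rewrite Cmod_opp.
assert (E : (Rabs (sum_n m K - L) < eps)%R) by exact HK0.
apply Rabs_def2 in E; lra.
Qed.

(** * Functions represented by a power series on a closed disc *)

(** The norm bound travels with the pointwise sum, so each operation on functions yields at once its
    coefficients, its norm estimate and its convergence on the closed disc. *)
Definition represents (r M : R) (a : nat -> C) (f : C -> C) : Prop :=
  ell1_bound r M a /\ forall z, (Cmod z <= r)%R -> is_pseries a z (f z).

Definition dilate (c : C) (a : nat -> C) (n : nat) : C := c ^ n * a n.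

(** These are the coefficients of the primitive vanishing at 0, divided by [z]; [PS_incr_1] restores
    the factor [z]. *)
Definition div_succ (a : nat -> C) (n : nat) : C := a n / RtoC (INR (S n)).

Definition deriv_seq (a : nat -> C) (n : nat) : C := RtoC (INR (S n)) * a (S n).

Lemma ell1_bound_le (r M M' : R) (a : nat -> C) :
  (M <= M')%R -> ell1_bound r M a -> ell1_bound r M' a.
Proof. intros H Ha N; exact (Rle_trans _ _ _ (Ha N) H). Qed.

Lemma ell1_bound_dominated (r M : R) (a b : nat -> C) :
  (0 <= r)%R -> (forall n, (Cmod (b n) <= Cmod (a n))%R) ->
  ell1_bound r M a -> ell1_bound r M b.
Proof.
intros Hr H Ha N; refine (Rle_trans _ _ _ _ (Ha N)).
apply sum_n_le_loc; intros n _.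
apply Rmult_le_compat_r; [now apply pow_le|apply H].
Qed.

Lemma represents_pseries_sum (r M : R) (a : nat -> C) :
  ell1_bound r M a -> represents r M a (pseries_sum a).
Proof.
intros H; split; [exact H|intros z Hz; exact (pseries_sum_correct r M a z Hz H)].
Qed.

Lemma represents_eq (r M : R) (a : nat -> C) (f : C -> C) (z : C) :
  (Cmod z <= r)%R -> represents r M a f -> f z = pseries_sum a z.
Proof. intros Hz [_ H]; symmetry; apply pseries_sum_unique, H, Hz. Qed.

Lemma represents_Cmod_le (r M : R) (a : nat -> C) (f : C -> C) (z : C) :
  (Cmod z <= r)%R -> represents r M a f -> (Cmod (f z) <= M)%R.
Proof. intros Hz [H1 H2]; exact (is_pseries_Cmod_le r M a z _ Hz H1 (H2 z Hz)). Qed.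

Lemma represents_plus (r M N : R) (a b : nat -> C) (f g : C -> C) :
  (0 <= r)%R -> represents r M a f -> represents r N b g ->
  represents r (M + N) (PS_plus a b) (fun z => f z + g z).
Proof.
intros Hr [Ha Hf] [Hb Hg]; split.
- intros K; eapply Rle_trans; [|exact (Rplus_le_compat _ _ _ _ (Ha K) (Hb K))].
  match goal with |- (_ <= ?x + ?y)%R => change (x + y)%R with (plus x y) end.
  rewrite <- sum_n_plus; apply sum_n_le_loc; intros n _.
  refine (Rle_trans _ _ _ (Rmult_le_compat_r _ _ _ (pow_le _ _ Hr) (Cmod_triangle _ _)) _).
  right; unfold plus; simpl; ring.
- intros z Hz; exact (is_pseries_plus _ _ _ _ _ (Hf z Hz) (Hg z Hz)).
Qed.

Lemma represents_scal (r M : R) (a : nat -> C) (f : C -> C) (c : C) :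
  represents r M a f -> represents r (Cmod c * M) (PS_scal c a) (fun z => c * f z).
Proof.
intros [Ha Hf]; split.
- intros K; eapply Rle_trans; [|exact (Rmult_le_compat_l _ _ _ (Cmod_ge_0 c) (Ha K))].
  right.
  refine (eq_trans _ (sum_n_mult_l (K := R_Ring) (Cmod c) (fun n => Cmod (a n) * r ^ n)%R K)).
  apply sum_n_ext; intros n; unfold PS_scal; change (scal c (a n)) with (c * a n).
  rewrite Cmod_mult; apply Rmult_assoc.
- intros z Hz; refine (is_pseries_scal _ _ _ _ _ (Hf z Hz)); apply Cmult_comm.
Qed.

Lemma represents_minus (r M N : R) (a b : nat -> C) (f g : C -> C) :
  (0 <= r)%R -> represents r M a f -> represents r N b g ->
  represents r (M + N) (PS_minus a b) (fun z => f z - g z).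
Proof.
intros Hr Ha [Hb Hg]; apply represents_plus; [exact Hr|exact Ha|split].
- refine (ell1_bound_dominated _ _ _ _ Hr _ Hb); intros n; right; apply Cmod_opp.
- intros z Hz; exact (is_pseries_opp _ _ _ (Hg z Hz)).
Qed.

Lemma represents_dilate (r M : R) (a : nat -> C) (f : C -> C) (c : C) :
  (0 <= r)%R -> (Cmod c <= 1)%R -> represents r M a f ->
  represents r M (dilate c a) (fun z => f (c * z)).
Proof.
intros Hr Hc [Ha Hf]; split.
- refine (ell1_bound_dominated _ _ _ _ Hr _ Ha); intros n; unfold dilate.
  rewrite Cmod_mult, Cmod_pow; apply Rle_trans with (1 ^ n * Cmod (a n))%R;
    [|rewrite pow1; lra].
  apply Rmult_le_compat_r; [apply Cmod_ge_0|].
  apply pow_incr; split; [apply Cmod_ge_0|exact Hc].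
- intros z Hz.
  assert (Hcz : (Cmod (c * z) <= r)%R).
  { rewrite Cmod_mult; pose proof (Cmod_ge_0 z); pose proof (Cmod_ge_0 c); nra. }
  refine (is_series_ext _ _ _ _ (Hf _ Hcz)); intros n; rewrite !pow_n_Cpow.
  change ((c * z) ^ n * a n = z ^ n * (c ^ n * a n)); rewrite Cpow_mult_l; ring.
Qed.

Lemma represents_incr_1 (r M : R) (a : nat -> C) (f : C -> C) :
  (0 <= r)%R -> represents r M a f ->
  represents r (r * M) (PS_incr_1 a) (fun z => z * f z).
Proof.
intros Hr [Ha Hf]; split.
- intros [|N].
  + rewrite sum_O; simpl; change (Cmod zero) with (Cmod 0); rewrite Cmod_0, Rmult_0_l.
    pose proof (ell1_bound_nonneg _ _ _ Ha); nra.
  + replace (S N) with (1 + N)%nat by reflexivity; rewrite sum_n_shift, sum_O.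
    simpl; change (Cmod zero) with (Cmod 0); rewrite Cmod_0, Rmult_0_l.
    change (plus 0%R ?x) with (0 + x)%R; rewrite Rplus_0_l.
    eapply Rle_trans; [|exact (Rmult_le_compat_l _ _ _ Hr (Ha N))]; right.
    refine (eq_trans _ (sum_n_mult_l (K := R_Ring) r (fun n => Cmod (a n) * r ^ n)%R N)).
    apply sum_n_ext; intros n; unfold mult; simpl; ring.
- intros z Hz; exact (is_pseries_incr_1 _ _ _ (Hf z Hz)).
Qed.

Lemma represents_incr_n (r M : R) (a : nat -> C) (f : C -> C) (k : nat) :
  (0 <= r)%R -> represents r M a f ->
  represents r (r ^ k * M) (PS_incr_n a k) (fun z => z ^ k * f z).
Proof.
intros Hr Ha; induction k as [|k [IH1 IH2]].
- destruct Ha as [Ha Hf]; split; [rewrite Rmult_1_l; exact Ha|].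
  intros z Hz; simpl; rewrite Cmult_1_l; exact (Hf z Hz).
- destruct (represents_incr_1 _ _ _ _ Hr (conj IH1 IH2)) as [H1 H2]; split.
  + simpl; rewrite Rmult_assoc; exact H1.
  + intros z Hz; simpl; rewrite <- Cmult_assoc; exact (H2 z Hz).
Qed.

Lemma PS_incr_n_C (a : nat -> C) (k n : nat) :
  PS_incr_n a k n = if (k <=? n)%nat then a (n - k)%nat else RtoC 0.
Proof.
revert n; induction k as [|k IH]; intros n; [simpl; now rewrite Nat.sub_0_r|].
destruct n as [|n]; [reflexivity|exact (IH n)].
Qed.

Lemma cauchy_prod_superpose (a b : nat -> C) (n : nat) :
  superpose (fun k => PS_scal (a k) (PS_incr_n b k)) n = cauchy_prod a b n.
Proof.
apply sum_n_ext_loc; intros k Hk; unfold PS_scal.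
rewrite PS_incr_n_C, (proj2 (Nat.leb_le k n) Hk); reflexivity.
Qed.

Lemma represents_superpose (r M : R) (m : nat -> R) (u : nat -> nat -> C)
    (U : nat -> C -> C) (f : C -> C) :
  (0 <= r)%R ->
  (forall k n, (n < k)%nat -> u k n = RtoC 0) ->
  (forall k, represents r (m k) (u k) (U k)) ->
  (forall K, (sum_n m K <= M)%R) ->
  (forall z, (Cmod z <= r)%R -> is_series (fun k => U k z) (f z)) ->
  represents r M (superpose u) f.
Proof.
intros Hr Hu HU HM Hf.
assert (HB : ell1_bound r M (superpose u))
  by (apply ell1_bound_superpose with (m := m); auto; intros k; apply HU).
split; [exact HB|]; intros z Hz.
rewrite (is_series_C_unique _ _ (pseries_sum (superpose u) z) (Hf z Hz)).
- now apply (pseries_sum_correct r M).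
- apply is_series_superpose with (r := r) (M := M) (m := m); auto; intros k; now apply HU.
Qed.

Lemma represents_ext (r M : R) (a b : nat -> C) (f : C -> C) :
  (forall n, a n = b n) -> represents r M a f -> represents r M b f.
Proof.
intros E [H1 H2]; split; [exact (ell1_bound_ext _ _ _ _ E H1)|].
intros z Hz; exact (is_pseries_ext _ _ _ _ E (H2 z Hz)).
Qed.

(** The product is the superposition of the series [a k * z^k * g], of norm at most [|a k| r^k N];
    summing over [k] gives [M * N]. *)
Lemma represents_prod (r M N : R) (a b : nat -> C) (f g : C -> C) :
  (0 <= r)%R -> represents r M a f -> represents r N b g ->
  represents r (M * N) (cauchy_prod a b) (fun z => f z * g z).
Proof.
intros Hr Ha Hb; pose proof (ell1_bound_nonneg _ _ _ (proj1 Hb)) as HN.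
apply (represents_ext _ _ _ _ _ (cauchy_prod_superpose a b)).
apply (represents_superpose r _ (fun k => Cmod (a k) * (r ^ k * N))%R _
         (fun k z => a k * (z ^ k * g z))); [exact Hr| | | |].
- intros k n Hk; unfold PS_scal; rewrite PS_incr_n_C.
  rewrite (proj2 (Nat.leb_gt k n) Hk); exact (Cmult_0_r _).
- intros k; exact (represents_scal _ _ _ _ _ (represents_incr_n _ _ _ _ k Hr Hb)).
- intros K; refine (Rle_trans _ _ _ _ (Rmult_le_compat_r _ _ _ HN (proj1 Ha K))); right.
  refine (eq_trans _ (sum_n_mult_r (K := R_Ring) N (fun n => Cmod (a n) * r ^ n)%R K)).
  apply sum_n_ext; intros n; unfold mult; simpl; ring.
- intros z Hz.
  pose proof (is_series_scal (g z) _ _ (proj2 Ha z Hz)) as H.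
  rewrite Cmult_comm; refine (is_series_ext _ _ _ _ H); intros n; rewrite pow_n_Cpow.
  change (g z * (z ^ n * a n) = a n * (z ^ n * g z)); ring.
Qed.

Lemma represents_const (r : R) (c : C) : represents r (Cmod c) (const_seq c) (fun _ => c).
Proof.
split.
- intros N; rewrite (sum_n_extend _ 0 N) by
    (lia || (intros [|n] Hn; [lia|simpl; rewrite Cmod_0; exact (Rmult_0_l _)])).
  rewrite sum_O; simpl; lra.
- intros z _; apply is_series_decr_1.
  refine (filterlim_ext (fun _ => zero) _ _ _).
  + intros n; symmetry; rewrite (sum_n_ext _ (fun _ => zero)).
    * exact (sum_n_m_const_zero 0 n).
    * intros m; exact (Cmult_0_r _).
  + refine (eq_ind zero (fun l : C => filterlim _ _ (locally l)) (filterlim_const _) _ _).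
    change (RtoC 0 = c + - (1 * c)); ring.
Qed.

Lemma represents_pow (r M : R) (a : nat -> C) (f : C -> C) (k : nat) :
  (0 <= r)%R -> represents r M a f ->
  represents r (M ^ k) (cauchy_pow a k) (fun z => f z ^ k).
Proof.
intros Hr Ha; induction k as [|k IH]; [|exact (represents_prod _ _ _ _ _ _ _ Hr Ha IH)].
simpl pow; rewrite <- Cmod_1; apply represents_const.
Qed.

Lemma cauchy_pow_low (a : nat -> C) (k n : nat) :
  a 0%nat = RtoC 0 -> (n < k)%nat -> cauchy_pow a k n = RtoC 0.
Proof.
intros Ha; revert n; induction k as [|k IH]; intros n Hn; [lia|].
simpl; unfold cauchy_prod; rewrite (sum_n_ext_loc _ (fun _ => zero)).
- exact (sum_n_m_const_zero 0 n).
- intros [|j] Hj; [rewrite Ha; exact (Cmult_0_l _)|].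
  rewrite IH by lia; exact (Cmult_0_r _).
Qed.

(** The [k]-th power of the inner series has norm at most [M ^ k <= s ^ k], so the norms of the
    terms [q k * f^k] add up to at most the norm of [q] at radius [s]. *)
Lemma represents_compose (r s M N : R) (q a : nat -> C) (F f : C -> C) :
  (0 <= r)%R -> (M <= s)%R -> a 0%nat = RtoC 0 ->
  represents s N q F -> represents r M a f ->
  represents r N (compose_seq q a) (fun z => F (f z)).
Proof.
intros Hr HM Ha0 HF Hf; pose proof (ell1_bound_nonneg _ _ _ (proj1 Hf)) as PM.
apply (represents_superpose r _ (fun k => Cmod (q k) * M ^ k)%R _
         (fun k z => q k * f z ^ k)); [exact Hr| | | |].
- intros k n Hk; rewrite (cauchy_pow_low a k n Ha0 Hk); apply Cmult_0_r.
- intros k; exact (represents_scal _ _ _ _ _ (represents_pow _ _ _ _ k Hr Hf)).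
- intros K; refine (Rle_trans _ _ _ _ (proj1 HF K)); apply sum_n_le_loc; intros n _.
  apply Rmult_le_compat_l; [apply Cmod_ge_0|now apply pow_incr].
- intros z Hz.
  assert (Hs : (Cmod (f z) <= s)%R)
    by exact (Rle_trans _ _ _ (represents_Cmod_le _ _ _ _ _ Hz Hf) HM).
  refine (is_series_ext _ _ _ _ (proj2 HF _ Hs)); intros n; rewrite pow_n_Cpow.
  apply Cmult_comm.
Qed.

Lemma Cmod_RtoC_INR (n : nat) : Cmod (RtoC (INR n)) = INR n.
Proof. rewrite Cmod_R; apply Rabs_pos_eq, pos_INR. Qed.

Lemma RtoC_INR_S_neq_0 (n : nat) : RtoC (INR (S n)) <> RtoC 0.
Proof. intros H; apply RtoC_inj in H; pose proof (lt_0_INR (S n) ltac:(lia)); lra. Qed.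

Lemma ell1_bound_div_succ (r M : R) (a : nat -> C) :
  (0 <= r)%R -> ell1_bound r M a -> ell1_bound r M (div_succ a).
Proof.
intros Hr; apply ell1_bound_dominated; [exact Hr|]; intros n; unfold div_succ.
pose proof (RtoC_INR_S_neq_0 n); rewrite Cmod_div, Cmod_RtoC_INR by assumption.
pose proof (Cmod_ge_0 (a n));
assert (1 <= INR (S n))%R by (rewrite S_INR; pose proof (pos_INR n); lra).
apply (Rmult_le_reg_r (INR (S n))); [lra|]; unfold Rdiv.
rewrite Rmult_assoc, Rinv_l by lra; nra.
Qed.

Lemma deriv_seq_primitive (a : nat -> C) (n : nat) :
  deriv_seq (PS_incr_1 (div_succ a)) n = a n.
Proof.
change (RtoC (INR (S n)) * (a n / RtoC (INR (S n))) = a n).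
field; apply RtoC_INR_S_neq_0.
Qed.

(** * Termwise differentiation *)

(** A remainder of order [|h|^2] is [o(h)]; power series provide such a remainder explicitly. *)
Lemma is_derive_quadratic (f : C -> C) (z l : C) (K d : R) :
  (0 < d)%R ->
  (forall h, (Cmod h < d)%R -> (Cmod (f (z + h)%C - f z - h * l) <= K * Cmod h ^ 2)%R) ->
  is_derive (K := C_AbsRing) (V := C_NormedModule) f z l.
Proof.
intros Hd H; split; [apply is_linear_scal_l|].
intros x Hx.
rewrite <- (is_filter_lim_locally_unique (K := C_AbsRing)
  (V := AbsRing_NormedModule C_AbsRing) _ _ Hx).
intros eps.
(* The sign of [K] is unknown; [Rabs K + 1] is a positive majorant by which one can divide. *)
assert (P : (0 < Rabs K + 1)%R) by (pose proof (Rabs_pos K); lra).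
assert (He : (0 < Rmin d (eps / (Rabs K + 1)))%R)
  by (apply Rmin_glb_lt; [exact Hd|apply Rdiv_lt_0_compat; [apply cond_pos|exact P]]).
exists (mkposreal _ He); intros y Hy.
assert (Hy' : (Cmod (y - z) < Rmin d (eps / (Rabs K + 1)))%R) by exact Hy.
change (Cmod (f y - f z - (y - z) * l) <= eps * Cmod (y - z))%R.
assert (E : forall u v : C, u + (v - u) = v) by (intros; ring).
specialize (H (y - z)); rewrite E in H.
eapply Rle_trans; [apply H, (Rlt_le_trans _ _ _ Hy'), Rmin_l|].
assert (Hq : (Cmod (y - z) * (Rabs K + 1) <= eps)%R).
{ apply Rle_trans with (eps / (Rabs K + 1) * (Rabs K + 1))%R.
  - apply Rmult_le_compat_r; [lra|].
    left; apply (Rlt_le_trans _ _ _ Hy'), Rmin_r.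
  - right; field; lra. }
pose proof (Cmod_ge_0 (y - z)); pose proof (Rle_abs K).
assert (K * Cmod (y - z) <= eps)%R by nra; nra.
Qed.

(** Each of the [n + 1] terms of [(r^(n+1) - s^(n+1)) / (r - s)] is at least [s^n]. This bounds the
    cost of a derivative by [1 / (r - s)], uniformly in [n], when the radius shrinks from [r] to
    [s]. *)
Lemma succ_pow_le (s r : R) (n : nat) :
  (0 <= s <= r)%R -> (INR (S n) * s ^ n * (r - s) <= r ^ S n)%R.
Proof.
intros Hs; induction n as [|n IH]; [simpl; lra|].
rewrite S_INR; assert (s ^ S n <= r ^ S n)%R by (apply pow_incr; lra).
assert (0 <= r - s)%R by lra.
replace ((INR (S n) + 1) * s ^ S n * (r - s))%R
  with (s * (INR (S n) * s ^ n * (r - s)) + s ^ S n * (r - s))%R by (simpl pow; ring).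
apply Rle_trans with (s * r ^ S n + r ^ S n * (r - s))%R; [|right; simpl; ring].
apply Rplus_le_compat; [apply Rmult_le_compat_l; lra|apply Rmult_le_compat_r; lra].
Qed.

Lemma ell1_bound_deriv (r s M : R) (a : nat -> C) :
  (0 <= s < r)%R -> ell1_bound r M a -> ell1_bound s (M / (r - s)) (deriv_seq a).
Proof.
intros Hs Ha N; apply (Rmult_le_reg_r (r - s)); [lra|].
replace (M / (r - s) * (r - s))%R with M by (field; lra).
refine (Rle_trans _ _ _ _ (Ha (S N))).
assert (P : forall k, (0 <= Cmod (a k) * r ^ k)%R)
  by (intros k; apply Rmult_le_pos; [apply Cmod_ge_0|apply pow_le; lra]).
replace (S N) with (1 + N)%nat by reflexivity; rewrite sum_n_shift, sum_O.
apply Rle_trans with (sum_n (fun k => Cmod (a (S k)) * r ^ S k)%R N).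
- refine (Rle_trans _ _ _ (Req_le _ _ (eq_sym (sum_n_mult_r (K := R_Ring) (r - s)%R _ N))) _).
  apply sum_n_le_loc; intros n _; unfold deriv_seq.
  rewrite Cmod_mult, Cmod_RtoC_INR; change mult with Rmult; cbv beta.
  pose proof (succ_pow_le s r n ltac:(lra)) as H.
  apply Rmult_le_compat_l with (r := Cmod (a (S n))) in H; [|apply Cmod_ge_0].
  lra.
- specialize (P 0%nat); unfold plus; simpl in P |- *; lra.
Qed.

Definition pow_deriv (z : C) (n : nat) : C :=
  match n with O => RtoC 0 | S m => RtoC (INR (S m)) * z ^ m end.

Lemma pow_deriv_S (z : C) (n : nat) : pow_deriv z (S n) = z * pow_deriv z n + z ^ n.
Proof.
destruct n as [|n]; [simpl; ring|].
unfold pow_deriv; rewrite (S_INR (S n)), RtoC_plus; simpl Cpow; ring.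
Qed.

Lemma pow_deriv_le (z : C) (s r : R) (n : nat) :
  (Cmod z <= s < r)%R -> (Cmod (pow_deriv z n) * (r - s) <= r ^ n)%R.
Proof.
intros Hz; pose proof (Cmod_ge_0 z); destruct n as [|n]; unfold pow_deriv.
- rewrite Cmod_0; simpl; lra.
- rewrite Cmod_mult, Cmod_RtoC_INR, Cmod_pow.
  refine (Rle_trans _ _ _ _ (succ_pow_le s r n ltac:(lra))).
  apply Rmult_le_compat_r; [lra|]; apply Rmult_le_compat_l; [apply pos_INR|].
  apply pow_incr; lra.
Qed.

(* With [D n = (z + h)^n - z^n - h n z^(n-1)] one has
   [D (n+1) = (z + h) D n + h^2 n z^(n-1)], so the bound follows by induction. *)
Lemma pow_taylor_le (z h : C) (s r : R) (n : nat) :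
  (Cmod z <= s < r)%R -> (Cmod (z + h) <= s)%R ->
  (Cmod ((z + h) ^ n - z ^ n - h * pow_deriv z n) * (r - s) ^ 2 <= Cmod h ^ 2 * r ^ n)%R.
Proof.
intros Hz Hzh; pose proof (Cmod_ge_0 z); pose proof (Cmod_ge_0 (z + h)).
induction n as [|n IH].
- simpl; replace (1 - 1 - h * 0) with (RtoC 0) by ring; rewrite Cmod_0.
  pose proof (Cmod_ge_0 h); nra.
- rewrite pow_deriv_S; simpl Cpow.
  set (D := (z + h) ^ n - z ^ n - h * pow_deriv z n) in IH.
  replace ((z + h) * (z + h) ^ n - z * z ^ n - h * (z * pow_deriv z n + z ^ n))
    with ((z + h) * D + h ^ 2 * pow_deriv z n) by (unfold D; simpl; ring).
  pose proof (pow_deriv_le z s r n Hz) as He.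
  refine (Rle_trans _ _ _ (Rmult_le_compat_r _ _ _ _ (Cmod_triangle _ _)) _); [nra|].
  rewrite !Cmod_mult, Cmod_pow.
  pose proof (Cmod_ge_0 D); pose proof (Cmod_ge_0 h).
  assert (A1 : (Cmod (z + h) * (Cmod D * (r - s) ^ 2) <= s * (Cmod h ^ 2 * r ^ n))%R).
  { apply Rmult_le_compat; [assumption| |assumption|exact IH].
    apply Rmult_le_pos; [assumption|nra]. }
  assert (A2 : (Cmod h ^ 2 * (r - s) * (Cmod (pow_deriv z n) * (r - s))
               <= Cmod h ^ 2 * (r - s) * r ^ n)%R).
  { apply Rmult_le_compat_l; [|exact He]. apply Rmult_le_pos; [nra|lra]. }
  simpl pow in *; lra.
Qed.

(** Summing the Taylor estimate for [z^n] against [|a n|] leaves a remainder of at most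
    [M |h|^2 / (r - s)^2]. Here [s] is midway between [|z|] and [r], so that [z + h] stays in the
    disc of radius [s] for small [h]. *)
Lemma is_derive_pseries_sum (r M : R) (a : nat -> C) (z : C) :
  ell1_bound r M a -> (Cmod z < r)%R ->
  is_derive (K := C_AbsRing) (V := C_NormedModule) (pseries_sum a) z
    (pseries_sum (deriv_seq a) z).
Proof.
intros Ha Hz; set (s := ((Cmod z + r) / 2)%R).
assert (Hs : (Cmod z < s < r)%R) by (unfold s; lra).
pose proof (Cmod_ge_0 z).
apply is_derive_quadratic with (K := (M / (r - s) ^ 2)%R) (d := (s - Cmod z)%R); [lra|].
intros h Hh.
assert (Hzh : (Cmod (z + h) <= s)%R) by (pose proof (Cmod_triangle z h); lra).
pose proof (pseries_sum_correct r M a (z + h) ltac:(lra) Ha) as H1.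
pose proof (pseries_sum_correct r M a z ltac:(lra) Ha) as H2.
pose proof (pseries_sum_correct s _ _ z ltac:(lra) (ell1_bound_deriv r s M a ltac:(lra) Ha)) as H3.
(* The derived series is reindexed to start with a zero term, so that it can be subtracted termwise
   from the series at [z + h] and [z]. *)
assert (H4 : is_series (K := C_AbsRing) (V := C_NormedModule)
               (fun n => pow_deriv z n * a n) (pseries_sum (deriv_seq a) z)).
{ apply is_series_decr_1; refine (eq_ind _ (is_series _) _ _ _).
  - refine (is_series_ext _ _ _ _ H3); intros n; rewrite pow_n_Cpow; unfold deriv_seq.
    change (z ^ n * (RtoC (INR (S n)) * a (S n)) = RtoC (INR (S n)) * z ^ n * a (S n)); ring.
  - change (pseries_sum (deriv_seq a) z = pseries_sum (deriv_seq a) z + - (0 * a 0%nat)); ring. }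
pose proof (is_series_minus _ _ _ _ (is_series_minus _ _ _ _ H1 H2)
              (is_series_scal h _ _ H4)) as H5.
refine (is_series_Cmod_le _ _ _ _ H5); intros N.
assert (Hq : (0 < (r - s) ^ 2)%R) by (apply pow_lt; lra).
apply (Rmult_le_reg_r ((r - s) ^ 2)); [exact Hq|].
replace (M / (r - s) ^ 2 * Cmod h ^ 2 * (r - s) ^ 2)%R with (Cmod h ^ 2 * M)%R by (field; lra).
refine (Rle_trans _ _ _ _ (Rmult_le_compat_l _ _ _ (pow2_ge_0 _) (Ha N))).
refine (Rle_trans _ _ _ (Req_le _ _ (eq_sym (sum_n_mult_r (K := R_Ring) ((r - s) ^ 2)%R _ N))) _).
refine (Rle_trans _ _ _ _ (Req_le _ _ (sum_n_mult_l (K := R_Ring) (Cmod h ^ 2)%R _ N))).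
apply sum_n_le_loc; intros n _; rewrite !pow_n_Cpow.
change (Cmod ((z + h) ^ n * a n + - (z ^ n * a n) + - (h * (pow_deriv z n * a n))) * (r - s) ^ 2
  <= Cmod h ^ 2 * (Cmod (a n) * r ^ n))%R.
replace ((z + h) ^ n * a n + - (z ^ n * a n) + - (h * (pow_deriv z n * a n)))
  with (((z + h) ^ n - z ^ n - h * pow_deriv z n) * a n) by ring.
rewrite Cmod_mult; pose proof (pow_taylor_le z h s r n ltac:(lra) Hzh) as T.
apply Rmult_le_compat_l with (r := Cmod (a n)) in T; [lra|apply Cmod_ge_0].
Qed.

(** * Changes of radius, derivatives of represented functions, local expansions *)

Lemma represents_le (r M M' : R) (a : nat -> C) (f : C -> C) :
  (M <= M')%R -> represents r M a f -> represents r M' a f.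
Proof. intros H [H1 H2]; split; [exact (ell1_bound_le _ _ _ _ H H1)|exact H2]. Qed.

Lemma represents_radius (r s M : R) (a : nat -> C) (f : C -> C) :
  (0 <= s <= r)%R -> represents r M a f -> represents s M a f.
Proof.
intros Hs [H1 H2]; split; [|intros z Hz; apply H2; lra].
intros N; refine (Rle_trans _ _ _ _ (H1 N)); apply sum_n_le_loc; intros n _.
apply Rmult_le_compat_l; [apply Cmod_ge_0|now apply pow_incr].
Qed.

Lemma locally_Cmod_lt (z : C) (r : R) (P : C -> Prop) :
  (Cmod z < r)%R -> (forall y, (Cmod y < r)%R -> P y) ->
  locally (T := AbsRing_UniformSpace C_AbsRing) z P.
Proof.
intros Hz H; assert (Hd : (0 < r - Cmod z)%R) by lra.
exists (mkposreal _ Hd); intros y Hy; apply H.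
assert (Hy' : (Cmod (y - z) < r - Cmod z)%R) by exact Hy.
assert (E : forall u v : C, v + (u - v) = u) by (intros; ring).
pose proof (Cmod_triangle z (y - z)) as T; rewrite E in T; lra.
Qed.

Lemma locally_origin (P : C -> Prop) :
  locally (RtoC 0) P <-> exists d, (0 < d)%R /\ forall z, (Cmod z < d)%R -> P z.
Proof.
split.
- intros H; apply locally_C in H; destruct H as [d Hd].
  exists d; split; [apply cond_pos|]; intros z Hz; apply Hd.
  change (Cmod (z - 0) < d)%R; replace (z - 0) with z by ring; exact Hz.
- intros [d [Hd H]]; apply locally_C, (locally_Cmod_lt 0 d); [|exact H].
  rewrite Cmod_0; exact Hd.
Qed.

Lemma represents_is_derive (r M : R) (a : nat -> C) (f : C -> C) (z : C) :
  (Cmod z < r)%R -> represents r M a f ->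
  is_derive (K := C_AbsRing) (V := C_NormedModule) f z (pseries_sum (deriv_seq a) z).
Proof.
intros Hz Hf; apply is_derive_ext_loc with (pseries_sum a).
- apply (locally_Cmod_lt z r); [exact Hz|]; intros y Hy; symmetry.
  apply (represents_eq r M); [lra|exact Hf].
- exact (is_derive_pseries_sum r M a z (proj1 Hf) Hz).
Qed.

(** The strict inequality [s < r] keeps the closed disc of radius [s] inside the open disc where
    termwise differentiation holds. *)
Lemma represents_C_derive (r s M : R) (a : nat -> C) (f : C -> C) :
  (0 <= s < r)%R -> represents r M a f ->
  represents s (M / (r - s)) (deriv_seq a) (C_derive f).
Proof.
intros Hs Hf; pose proof (ell1_bound_deriv r s M a Hs (proj1 Hf)) as Hd.
split; [exact Hd|]; intros z Hz.
rewrite (is_C_derive_unique f z (pseries_sum (deriv_seq a) z)).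
- exact (pseries_sum_correct s _ _ z Hz Hd).
- apply (represents_is_derive r M); [lra|exact Hf].
Qed.

Lemma is_derive_primitive (r M N : R) (a : nat -> C) (A f : C -> C) (z : C) :
  (Cmod z < r)%R -> represents r M (PS_incr_1 (div_succ a)) A -> represents r N a f ->
  is_derive (K := C_AbsRing) (V := C_NormedModule) A z (f z).
Proof.
intros Hz HA Hf.
rewrite (represents_eq r N a f z) by (lra || assumption).
refine (eq_ind _ (is_derive A z) (represents_is_derive r M _ A z Hz HA) _ _).
apply pseries_sum_unique.
apply (is_pseries_ext a _ z _ (fun n => eq_sym (deriv_seq_primitive a n))).
apply (pseries_sum_correct r N); [lra|exact (proj1 Hf)].
Qed.

(** Convergence at one point [x > 0] bounds the terms [|c n| x^n]; at radius [x / 2] they are then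
    dominated by a geometric series of ratio 1/2. *)
Lemma has_expansion_represents (f : C -> C) (c : nat -> C) :
  has_expansion f c -> exists r M, (0 < r)%R /\ represents r M c f.
Proof.
intros H; apply locally_origin in H; destruct H as [d [Hd H]].
set (x := (d / 2)%R); assert (Hx : (0 < x < d)%R) by (unfold x; lra).
assert (Cx : Cmod (RtoC x) = x) by (rewrite Cmod_R; apply Rabs_pos_eq; lra).
assert (Hs : is_pseries c (RtoC x) (f (RtoC x))) by (apply H; rewrite Cx; lra).
destruct (filterlim_bounded _ (ex_intro _ _ Hs)) as [B HB].
(* Each term is the difference of two consecutive partial sums, and [B] bounds all of these. *)
assert (Hc : forall n, (Cmod (c n) * x ^ n <= 2 * B)%R).
{ intros n.
  assert (E : (Cmod (c n) * x ^ n)%R = Cmod (scal (pow_n (RtoC x) n) (c n))).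
  { change (scal (pow_n (RtoC x) n) (c n)) with (pow_n (RtoC x) n * c n).
    rewrite pow_n_Cpow, Cmod_mult, Cmod_pow, Cx; ring. }
  rewrite E; destruct n as [|n].
  - pose proof (HB 0%nat) as H0; rewrite sum_O in H0.
    change (Cmod (scal (pow_n (RtoC x) 0) (c 0%nat)) <= B)%R in H0.
    pose proof (Cmod_ge_0 (scal (pow_n (RtoC x) 0) (c 0%nat))); lra.
  - pose proof (HB n) as H1; pose proof (HB (S n)) as H2; rewrite sum_Sn in H2.
    set (S0 := sum_n _ n) in H1, H2; set (t := scal _ (c (S n))) in H2 |- *.
    change (Cmod S0 <= B)%R in H1; change (Cmod (S0 + t) <= B)%R in H2.
    pose proof (Cmod_triangle (S0 + t) (- S0)) as T; rewrite Cmod_opp in T.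
    assert (E1 : forall u v : C, u + v + - u = v) by (intros; ring).
    rewrite E1 in T; lra. }
assert (Hg : forall N, sum_n (fun n => (/ 2) ^ n)%R N = (2 - (/ 2) ^ N)%R).
{ induction N as [|N IH]; [rewrite sum_O; simpl; lra|].
  rewrite sum_Sn, IH; unfold plus; simpl; lra. }
pose proof (Hc 0%nat) as HB0; pose proof (Cmod_ge_0 (c 0%nat)); simpl in HB0.
exists (x / 2)%R, (4 * B)%R; split; [lra|split].
- intros N; apply Rle_trans with (sum_n (fun n => 2 * B * (/ 2) ^ n)%R N).
  + apply sum_n_le_loc; intros n _; unfold Rdiv; rewrite Rpow_mult_distr, <- Rmult_assoc.
    apply Rmult_le_compat_r; [apply pow_le; lra|apply Hc].
  + refine (Rle_trans _ _ _ (Req_le _ _ (sum_n_mult_l (K := R_Ring) (2 * B)%R _ N)) _).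
    rewrite Hg; unfold mult; simpl.
    assert (0 < (/ 2) ^ N)%R by (apply pow_lt; lra); nra.
- intros z Hz; apply H; lra.
Qed.

(** * Causal maps on sequences *)

(** Congruence of power series modulo [z^n]. *)
Definition agree (n : nat) (u v : nat -> C) : Prop :=
  forall k, (k < n)%nat -> u k = v k.

Lemma agree_plus (n : nat) (u u' v v' : nat -> C) :
  agree n u u' -> agree n v v' -> agree n (PS_plus u v) (PS_plus u' v').
Proof. intros H H' k Hk; unfold PS_plus; now rewrite H, H'. Qed.

Lemma agree_minus (n : nat) (u u' v v' : nat -> C) :
  agree n u u' -> agree n v v' -> agree n (PS_minus u v) (PS_minus u' v').
Proof. intros H H' k Hk; unfold PS_minus, PS_plus, PS_opp; now rewrite H, H'. Qed.

Lemma agree_scal (n : nat) (c : C) (u u' : nat -> C) :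
  agree n u u' -> agree n (PS_scal c u) (PS_scal c u').
Proof. intros H k Hk; unfold PS_scal; now rewrite H. Qed.

Lemma agree_dilate (n : nat) (c : C) (u u' : nat -> C) :
  agree n u u' -> agree n (dilate c u) (dilate c u').
Proof. intros H k Hk; unfold dilate; now rewrite H. Qed.

Lemma agree_div_succ (n : nat) (u u' : nat -> C) :
  agree n u u' -> agree n (div_succ u) (div_succ u').
Proof. intros H k Hk; unfold div_succ; now rewrite H. Qed.

Lemma agree_incr_1 (n : nat) (u u' : nat -> C) :
  agree n u u' -> agree (S n) (PS_incr_1 u) (PS_incr_1 u').
Proof. intros H [|k] Hk; [reflexivity|apply H; lia]. Qed.

Lemma agree_lt (m n : nat) (u u' : nat -> C) :
  (m <= n)%nat -> agree n u u' -> agree m u u'.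
Proof. intros Hmn H k Hk; apply H; lia. Qed.

Lemma agree_prod (n : nat) (u u' v v' : nat -> C) :
  agree n u u' -> agree n v v' -> agree n (cauchy_prod u v) (cauchy_prod u' v').
Proof.
intros H H' k Hk; apply sum_n_ext_loc; intros j Hj; now rewrite H, H' by lia.
Qed.

Lemma agree_pow (n : nat) (u u' : nat -> C) (k : nat) :
  agree n u u' -> agree n (cauchy_pow u k) (cauchy_pow u' k).
Proof.
intros H; induction k as [|k IH]; [now intros j Hj|exact (agree_prod _ _ _ _ _ H IH)].
Qed.

Lemma agree_compose (n : nat) (q u u' : nat -> C) :
  agree n u u' -> agree n (compose_seq q u) (compose_seq q u').
Proof.
intros H k Hk; apply sum_n_ext; intros j; now rewrite (agree_pow n u u' j H k Hk).
Qed.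

(** Each application of [T] settles one more coefficient, so the iterates from 0 stabilise
    coefficientwise and the diagonal is a fixed point. No contraction estimate is involved: the norm
    bound passes to the diagonal because a partial sum up to [N] only sees the iterate [W (S N)]. *)
Lemma causal_fixpoint (T : (nat -> C) -> nat -> C) (r M : R) :
  (0 <= M)%R ->
  (forall n u v, agree n u v -> agree (S n) (T u) (T v)) ->
  (forall u, ell1_bound r M u -> ell1_bound r M (T u)) ->
  exists w, ell1_bound r M w /\ forall n, T w n = w n.
Proof.
intros HM HT HB.
set (W := fix W k := match k with O => const_seq (RtoC 0) | S k => T (W k) end).
assert (HW : forall k j, agree k (W k) (W (k + j)%nat)).
{ induction k as [|k IH]; intros j; [intros i Hi; lia|exact (HT _ _ _ (IH j))]. }
assert (HWB : forall k, ell1_bound r M (W k)).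
{ induction k as [|k IH]; [|exact (HB _ IH)].
  refine (ell1_bound_le _ _ _ _ _ (proj1 (represents_const r (RtoC 0)))).
  rewrite Cmod_0; exact HM. }
assert (Hw : forall n, agree n (fun k => W (S k) k) (W n)).
{ intros n k Hk; replace n with (S k + (n - S k))%nat by lia; apply HW; lia. }
exists (fun k => W (S k) k); split.
- intros N; refine (Rle_trans _ _ _ (Req_le _ _ _) (HWB (S N) N)).
  apply sum_n_ext_loc; intros n Hn; now rewrite (Hw (S N) n) by lia.
(* The diagonal agrees with [W n] below [n], and [T (W n)] is [W (S n)], whose coefficient [n] is
   the diagonal one. *)
- intros n; exact (HT _ _ _ (Hw n) n (Nat.lt_succ_diag_r n)).
Qed.

(** * The equation *)

Definition primitive (w : nat -> C) : nat -> C := PS_incr_1 (div_succ w).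

(** Coefficients of [rhs_fun], with [w] those of [g'], [pc] those of [p] and [q] those of [Q]. *)
Definition rhs_seq (a0 a1 gamma : C) (pc q w : nat -> C) : nat -> C :=
  PS_plus
    (PS_minus
      (PS_scal gamma
        (cauchy_prod
          (PS_minus (dilate (gamma ^ 2) (primitive w))
             (dilate gamma (compose_seq pc (primitive w))))
          (dilate gamma w)))
      (PS_scal (a1 * gamma) (dilate gamma w)))
    (cauchy_prod
      (PS_minus (compose_seq q (primitive w)) (PS_scal a0 (dilate gamma (primitive w))))
      w).

(** This is the [F] of the overview: with [Q = b h' + a2 p'' + a1 p' + a0 p], the auxiliary equation
    reads [a2 gamma (gamma g''(gamma z) g'(z) - g'(gamma z) g''(z)) = g'(z)^2 F(z)]. *)
Definition rhs_fun (a0 a1 gamma : C) (p Q g g' : C -> C) (z : C) : C :=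
  gamma * ((g (gamma ^ 2 * z) - p (g (gamma * z))) * g' (gamma * z))
  - a1 * gamma * g' (gamma * z)
  + (Q (g z) - a0 * g (gamma * z)) * g' z.

Definition rhs_bound (a0 a1 gamma : C) (Mp Mq m : R) : R :=
  Cmod gamma * ((m + Mp) * m) + Cmod (a1 * gamma) * m + (Mq + Cmod a0 * m) * m.

(** Here [m'] bounds [g] and [m] bounds [g']: [m' <= s] permits the compositions with [g], and
    [m' <= m] makes the final bound independent of [r], so that [r] can be chosen afterwards. *)
Lemma represents_rhs (a0 a1 gamma : C) (r s m m' Mp Mq : R) (pc q w : nat -> C)
    (p Q g g' : C -> C) :
  (0 <= r)%R -> (Cmod gamma <= 1)%R -> (m' <= s)%R -> (m' <= m)%R ->
  represents s Mp pc p -> represents s Mq q Q ->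
  represents r m' (primitive w) g -> represents r m w g' ->
  represents r (rhs_bound a0 a1 gamma Mp Mq m)
    (rhs_seq a0 a1 gamma pc q w) (rhs_fun a0 a1 gamma p Q g g').
Proof.
intros Hr Hg Hs Hm Hp HQ Hprim Hw.
assert (Hg2 : (Cmod (gamma ^ 2) <= 1)%R)
  by (rewrite Cmod_pow; pose proof (Cmod_ge_0 gamma); simpl; nra).
pose proof (represents_le _ _ _ _ _ Hm Hprim) as Hprim'.
pose proof (represents_dilate _ _ _ _ _ Hr Hg Hw) as Dw.
pose proof (represents_compose _ _ _ _ _ _ _ _ Hr Hs
  (eq_refl : primitive w 0 = RtoC 0) Hp Hprim) as Cp.
pose proof (represents_compose _ _ _ _ _ _ _ _ Hr Hs
  (eq_refl : primitive w 0 = RtoC 0) HQ Hprim) as CQ.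
exact (represents_plus _ _ _ _ _ _ _ Hr
  (represents_minus _ _ _ _ _ _ _ Hr
    (represents_scal _ _ _ _ gamma
      (represents_prod _ _ _ _ _ _ _ Hr
        (represents_minus _ _ _ _ _ _ _ Hr (represents_dilate _ _ _ _ _ Hr Hg2 Hprim')
          (represents_dilate _ _ _ _ _ Hr Hg Cp))
        Dw))
    (represents_scal _ _ _ _ (a1 * gamma) Dw))
  (represents_prod _ _ _ _ _ _ _ Hr
    (represents_minus _ _ _ _ _ _ _ Hr CQ
      (represents_scal _ _ _ _ a0 (represents_dilate _ _ _ _ _ Hr Hg Hprim')))
    Hw)).
Qed.

Lemma agree_rhs (a0 a1 gamma : C) (pc q : nat -> C) (n : nat) (u v : nat -> C) :
  agree n u v -> agree n (rhs_seq a0 a1 gamma pc q u) (rhs_seq a0 a1 gamma pc q v).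
Proof.
intros H.
assert (Hp : agree n (primitive u) (primitive v))
  by exact (agree_lt _ _ _ _ (Nat.le_succ_diag_r n) (agree_incr_1 _ _ _ (agree_div_succ _ _ _ H))).
unfold rhs_seq.
auto 20 using agree_plus, agree_minus, agree_scal, agree_dilate, agree_prod, agree_compose.
Qed.

(** The reverse triangle inequality with [|gamma^(n+1)| <= |gamma|]: the divisors of the recurrence
    stay away from 0. *)
Lemma one_sub_Cmod_le (gamma : C) (n : nat) :
  (Cmod gamma < 1)%R -> (1 - Cmod gamma <= Cmod (gamma ^ S n - 1))%R.
Proof.
intros Hg; pose proof (Cmod_ge_0 gamma).
assert (Hn : (Cmod (gamma ^ S n) <= Cmod gamma)%R).
{ rewrite Cmod_pow; simpl; assert (Cmod gamma ^ n <= 1 ^ n)%R by (apply pow_incr; lra).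
  rewrite pow1 in *; nra. }
pose proof (Cmod_triangle (gamma ^ S n) (- (gamma ^ S n - 1))) as T.
replace (gamma ^ S n + - (gamma ^ S n - 1)) with (RtoC 1) in T by ring.
rewrite Cmod_opp, Cmod_1 in T; lra.
Qed.

Lemma solution_coefficients (a0 a1 a2 gamma eta : C) (s Mp Mq : R) (pc q : nat -> C) :
  a2 <> RtoC 0 -> (0 < Cmod gamma < 1)%R -> eta <> RtoC 0 -> (0 < s)%R ->
  ell1_bound s Mp pc -> ell1_bound s Mq q ->
  let m := (2 * Cmod eta)%R in
  exists (r : R) (w : nat -> C),
    (0 < r)%R /\ (r * m <= s)%R /\ (r * m <= m)%R /\ ell1_bound r m w /\
    w 0%nat = eta /\
    forall n, a2 * gamma * (gamma ^ S n - 1) * w (S n) =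
      cauchy_prod w (div_succ (rhs_seq a0 a1 gamma pc q w)) n.
Proof.
intros Ha2 Hg Heta Hs Hp Hq m.
apply Cmod_gt_0 in Ha2; apply Cmod_gt_0 in Heta.
assert (Pm : (0 < m)%R) by (unfold m; lra).
pose proof (ell1_bound_nonneg _ _ _ Hp); pose proof (ell1_bound_nonneg _ _ _ Hq).
set (B := rhs_bound a0 a1 gamma Mp Mq m).
assert (PB : (0 <= B)%R).
{ pose proof (Cmod_ge_0 (a1 * gamma)); pose proof (Cmod_ge_0 a0); unfold B, rhs_bound.
  repeat (apply Rplus_le_le_0_compat || apply Rmult_le_pos); lra. }
(* [K] bounds the inverses of all divisors [a2 gamma (gamma^(n+1) - 1)]. *)
set (K := (/ (Cmod a2 * Cmod gamma * (1 - Cmod gamma)))%R).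
assert (Pd : (0 < Cmod a2 * Cmod gamma * (1 - Cmod gamma))%R)
  by (repeat apply Rmult_lt_0_compat; lra).
assert (PK : (0 < K)%R) by (apply Rinv_0_lt_compat, Pd).
assert (PKB : (0 <= K * (m * B))%R) by (repeat apply Rmult_le_pos; lra).
(* The ball of radius [m = 2 |eta|] splits in halves: the constant term uses [|eta|], and the last
   condition on [r] confines the rest to the other [|eta|]. *)
assert (Hr : exists r, (0 < r)%R /\ (r <= 1)%R /\ (r * m <= s)%R /\
                       (r * (K * (m * B)) <= Cmod eta)%R).
{ exists (Rmin 1 (Rmin (s / m) (Cmod eta / (K * (m * B) + 1)))).
  assert (H1 : (0 < s / m)%R) by (apply Rdiv_lt_0_compat; lra).
  assert (H2 : (0 < Cmod eta / (K * (m * B) + 1))%R) by (apply Rdiv_lt_0_compat; lra).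
  pose proof (Rmin_l 1 (Rmin (s / m) (Cmod eta / (K * (m * B) + 1)))).
  pose proof (Rmin_r 1 (Rmin (s / m) (Cmod eta / (K * (m * B) + 1)))).
  pose proof (Rmin_l (s / m) (Cmod eta / (K * (m * B) + 1))).
  pose proof (Rmin_r (s / m) (Cmod eta / (K * (m * B) + 1))).
  set (r := Rmin 1 _) in *.
  assert (P : (0 < r)%R) by (repeat apply Rmin_glb_lt; lra).
  repeat split; [exact P|assumption| |].
  - replace s with (s / m * m)%R by (field; lra); apply Rmult_le_compat_r; lra.
  - apply Rle_trans with (r * (K * (m * B) + 1))%R; [apply Rmult_le_compat_l; lra|].
    apply Rle_trans with (Cmod eta / (K * (m * B) + 1) * (K * (m * B) + 1))%R.
    + apply Rmult_le_compat_r; lra.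
    + right; field; lra. }
destruct Hr as [r [Pr [Hr1 [Hrs HrK]]]].
assert (Hr0 : (0 <= r)%R) by lra; assert (Hrm : (r * m <= m)%R) by nra.
assert (Hd : forall n, (Cmod a2 * Cmod gamma * (1 - Cmod gamma) <=
                        Cmod (a2 * gamma * (gamma ^ S n - 1)))%R).
{ intros n; rewrite !Cmod_mult; apply Rmult_le_compat_l; [|apply one_sub_Cmod_le; lra].
  apply Rmult_le_pos; lra. }
assert (Hd0 : forall n, a2 * gamma * (gamma ^ S n - 1) <> RtoC 0)
  by (intros n; apply Cmod_gt_0; specialize (Hd n); lra).
(* [V w] is the series of [g'] times the primitive of [F], divided by [z]; its coefficient [n]
   therefore determines [w (S n)]. *)
set (V := fun w => cauchy_prod w (div_succ (rhs_seq a0 a1 gamma pc q w))).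
destruct (causal_fixpoint
  (fun w => PS_plus (const_seq eta)
     (PS_incr_1 (fun n => V w n / (a2 * gamma * (gamma ^ S n - 1))))) r m) as [w [Hw Hfix]].
- lra.
- intros n u v Huv; apply agree_plus; [now intros k Hk|].
  (* The shift by [z] supplies the additional settled coefficient required by [causal_fixpoint]. *)
  apply agree_incr_1; intros k Hk; unfold V.
  now rewrite (agree_prod n _ _ _ _ Huv (agree_div_succ _ _ _ (agree_rhs _ _ _ _ _ _ _ _ Huv))).
- intros u Hu.
  pose proof (represents_pseries_sum r m u Hu) as Ru.
  pose proof (represents_incr_1 r m _ _ Hr0
    (represents_pseries_sum r m _ (ell1_bound_div_succ r m u Hr0 Hu))) as Rg.
  pose proof (represents_rhs a0 a1 gamma r s m (r * m) Mp Mq pc q u _ _ _ _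
    ltac:(lra) ltac:(lra) Hrs Hrm (represents_pseries_sum _ _ _ Hp)
    (represents_pseries_sum _ _ _ Hq) Rg Ru) as RF.
  pose proof (represents_prod _ _ _ _ _ _ _ Hr0 Ru
    (represents_pseries_sum r B _ (ell1_bound_div_succ r B _ Hr0 (proj1 RF)))) as RV.
  assert (HV : ell1_bound r (K * (m * B))
            (fun n => V u n / (a2 * gamma * (gamma ^ S n - 1)))).
  { pose proof (represents_scal _ _ _ _ (RtoC K) RV) as [H1 _].
    rewrite Cmod_R, Rabs_pos_eq in H1 by lra.
    refine (ell1_bound_dominated _ _ _ _ _ _ H1); [lra|]; intros n.
    change (Cmod (V u n / (a2 * gamma * (gamma ^ S n - 1))) <= Cmod (RtoC K * V u n))%R.
    rewrite (Cmod_mult (RtoC K)), Cmod_R, Rabs_pos_eq, Cmod_div by (apply Hd0 || lra).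
    rewrite Rmult_comm; apply Rmult_le_compat_l; [apply Cmod_ge_0|].
    apply Rinv_le_contravar; [exact Pd|apply Hd]. }
  refine (ell1_bound_le _ _ _ _ _ (proj1 (represents_plus _ _ _ _ _ _ _ Hr0
    (represents_const r eta)
    (represents_incr_1 _ _ _ _ Hr0 (represents_pseries_sum _ _ _ HV)))));
    change m with (2 * Cmod eta)%R at 2; lra.
- exists r, w; split; [exact Pr|split; [exact Hrs|split; [exact Hrm|split; [exact Hw|split]]]].
  + rewrite <- Hfix; change (eta + 0 = eta); ring.
  + intros n; rewrite <- (Hfix (S n)) at 1.
    change (a2 * gamma * (gamma ^ S n - 1) *
      (0 + V w n / (a2 * gamma * (gamma ^ S n - 1))) = V w n).
    specialize (Hd0 n); set (D := a2 * gamma * (gamma ^ S n - 1)) in *; field; exact Hd0.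
Qed.

(** * From the integrated equation back to the auxiliary equation *)

Lemma Cmod_scaled_lt (gamma z : C) (r : R) :
  (Cmod gamma <= 1)%R -> (Cmod z < r)%R -> (Cmod (gamma * z) < r)%R.
Proof.
intros Hg Hz; rewrite Cmod_mult; pose proof (Cmod_ge_0 gamma); pose proof (Cmod_ge_0 z); nra.
Qed.

(* Coquelicot carries two normed module structures on [C], which differ only in the
   topology attached to the codomain. *)
Lemma is_derive_C_ring (f : C -> C) (z l : C) :
  is_derive (K := C_AbsRing) (V := C_NormedModule) f z l <->
  is_derive (K := C_AbsRing) (V := AbsRing_NormedModule C_AbsRing) f z l.
Proof. split; intros [_ H]; (split; [apply is_linear_scal_l|exact H]). Qed.

(** Both sides of the integrated equation are differentiated and compared by uniqueness of the
    derivative. The product form [f * I] avoids the quotient [f(gamma z) / f(z)], hence any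
    discussion of zeros of [f]. *)
Lemma integrated_equation_derivative (a2 gamma : C) (r : R) (f f' I F : C -> C) (z : C) :
  (Cmod gamma <= 1)%R -> (Cmod z < r)%R ->
  (forall y, (Cmod y < r)%R ->
    is_derive (K := C_AbsRing) (V := C_NormedModule) f y (f' y)) ->
  is_derive (K := C_AbsRing) (V := C_NormedModule) I z (F z) ->
  (forall y, (Cmod y < r)%R -> a2 * gamma * (f (gamma * y) - f y) = f y * I y) ->
  a2 * gamma * (gamma * f' (gamma * z) - f' z) = f' z * I z + f z * F z.
Proof.
intros Hg Hz Hf HI E.
pose proof (Cmod_scaled_lt gamma z r Hg Hz) as Hgz.
assert (D1 : is_derive (K := C_AbsRing) (V := C_NormedModule)
               (fun y => f y * I y) z (f' z * I z + f z * F z))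
  by exact (proj2 (is_derive_C_ring _ _ _) (is_derive_mult (K := C_AbsRing) f I z (f' z) (F z)
       (proj1 (is_derive_C_ring _ _ _) (Hf z Hz)) (proj1 (is_derive_C_ring _ _ _) HI) Cmult_comm)).
assert (Dg : is_derive (K := C_AbsRing) (V := AbsRing_NormedModule C_AbsRing)
               (fun y : C => gamma * y) z gamma).
{ apply (proj1 (is_derive_C_ring (fun y => gamma * y) z gamma)),
    (is_derive_quadratic _ _ _ 0 1); [lra|]; intros h _.
  replace (gamma * (z + h) - gamma * z - h * gamma) with (RtoC 0) by ring.
  rewrite Cmod_0; lra. }
pose proof (is_derive_comp (K := C_AbsRing) (V := C_NormedModule) f _ z _ _ (Hf _ Hgz) Dg) as D2.
pose proof (is_derive_scal_l (K := C_AbsRing) (V := C_NormedModule) _ z _ (a2 * gamma)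
  (proj1 (is_derive_C_ring _ _ _) (is_derive_minus _ _ _ _ _ D2 (Hf z Hz)))) as D3.
assert (D4 : is_derive (K := C_AbsRing) (V := C_NormedModule) (fun y => f y * I y) z
               ((gamma * f' (gamma * z) - f' z) * (a2 * gamma))).
{ refine (is_derive_ext_loc _ _ _ _ _ D3).
  apply (locally_Cmod_lt z r); [exact Hz|]; intros y Hy; rewrite <- E by exact Hy.
  apply Cmult_comm. }
rewrite <- (is_C_derive_unique _ _ _ D1), (is_C_derive_unique _ _ _ D4); ring.
Qed.

Theorem theorem2p1 :
  forall (a0 a1 a2 b : C) (p h : C -> C) (gamma eta : C),
    a2 <> RtoC 0 ->
    analytic_near_origin p ->
    analytic_near_origin h ->
    (0 < Cmod gamma < 1)%R ->
    eta <> RtoC 0 ->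
    exists (g : C -> C) (c : nat -> C),
      has_expansion g c /\
      c O = RtoC 0 /\
      g (RtoC 0) = RtoC 0 /\
      C_derive g (RtoC 0) = eta /\
      locally (RtoC 0)
        (fun z : C => auxiliary_equation a0 a1 a2 b gamma p h g z).
Proof.
intros a0 a1 a2 b p h gamma eta Ha2 [pc Hpc] [hc Hhc] Hg Heta.
destruct (has_expansion_represents p pc Hpc) as [rp [Mp [Prp Hp]]].
destruct (has_expansion_represents h hc Hhc) as [rh [Mh [Prh Hh]]].
set (t := Rmin rp rh).
assert (Pt : (0 < t)%R) by (apply Rmin_glb_lt; assumption).
assert (Htp : (t <= rp)%R) by apply Rmin_l; assert (Hth : (t <= rh)%R) by apply Rmin_r.
(* Two derivatives of [p] need two strict shrinkings, from [rp] to [2 * s] and then to [s]. *)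
set (s := (t / 3)%R).
pose proof (represents_C_derive rp (2 * s) _ _ _ ltac:(unfold s; lra) Hp) as Hp1.
pose proof (represents_C_derive (2 * s) s _ _ _ ltac:(unfold s; lra) Hp1) as Hp2.
pose proof (represents_C_derive rh s _ _ _ ltac:(unfold s; lra) Hh) as Hh1.
apply (represents_radius _ s) in Hp1; [|unfold s; lra].
apply (represents_radius _ s) in Hp; [|unfold s; lra].
assert (Ps : (0 < s)%R) by (unfold s; lra).
pose proof (represents_plus _ _ _ _ _ _ _ (Rlt_le _ _ Ps) (represents_scal _ _ _ _ b Hh1)
  (represents_plus _ _ _ _ _ _ _ (Rlt_le _ _ Ps)
    (represents_plus _ _ _ _ _ _ _ (Rlt_le _ _ Ps)
      (represents_scal _ _ _ _ a2 Hp2) (represents_scal _ _ _ _ a1 Hp1))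
    (represents_scal _ _ _ _ a0 Hp))) as HQ.
destruct (solution_coefficients a0 a1 a2 gamma eta s _ _ _ _ Ha2 Hg Heta Ps (proj1 Hp) (proj1 HQ))
  as [r0 [w [Pr0 [Hrs [Hrm [Hw [Hw0 Hrec]]]]]]].
set (m := (2 * Cmod eta)%R) in *.
set (g := pseries_sum (primitive w)).
assert (Rg0 : represents r0 (r0 * m) (primitive w) g).
{ apply represents_pseries_sum.
  exact (proj1 (represents_incr_1 r0 m _ _ (Rlt_le _ _ Pr0)
    (represents_pseries_sum r0 m _ (ell1_bound_div_succ r0 m w (Rlt_le _ _ Pr0) Hw)))). }
pose proof (represents_pseries_sum r0 m w Hw) as Rw0.
(* [C_derive g] is identified only on the open disc of radius [r0], so a closed disc strictly inside
   is taken. *)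
set (r := (r0 / 2)%R); assert (Hr : (0 < r < r0)%R) by (unfold r; lra).
assert (Hg' : forall z, (Cmod z < r0)%R -> C_derive g z = pseries_sum w z).
{ intros z Hz; apply is_C_derive_unique.
  exact (is_derive_primitive r0 _ _ w g _ z Hz Rg0 Rw0). }
assert (Rw : represents r m w (C_derive g)).
{ destruct (represents_radius r0 r _ _ _ ltac:(lra) Rw0) as [H1 H2]; split; [exact H1|].
  intros z Hz; rewrite Hg' by lra; exact (H2 z Hz). }
assert (Rg : represents r (r0 * m) (primitive w) g)
  by (apply (represents_radius r0); [lra|exact Rg0]).
pose proof (represents_rhs a0 a1 gamma r s m _ _ _ _ _ _ _ _ _ _
  (Rlt_le _ _ (proj1 Hr)) ltac:(lra) Hrs Hrm Hp HQ Rg Rw) as RF.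
set (F := rhs_fun _ _ _ _ _ _ _) in RF.
set (Fc := rhs_seq _ _ _ _ _ _) in RF, Hrec.
pose proof (represents_pseries_sum _ _ _
  (ell1_bound_div_succ r _ _ (Rlt_le _ _ (proj1 Hr)) (proj1 RF))) as RL.
(* [I] is the primitive of [F] vanishing at 0. *)
set (I := fun z => z * pseries_sum (div_succ Fc) z).
pose proof (represents_incr_1 _ _ _ _ (Rlt_le _ _ (proj1 Hr)) RL) as RI.
assert (E : forall y, (Cmod y < r)%R ->
  a2 * gamma * (C_derive g (gamma * y) - C_derive g y) = C_derive g y * I y).
{ intros y Hy.
  pose proof (represents_scal _ _ _ _ (a2 * gamma)
    (represents_minus _ _ _ _ _ _ _ (Rlt_le _ _ (proj1 Hr))
      (represents_dilate _ _ _ _ gamma (Rlt_le _ _ (proj1 Hr)) ltac:(lra) Rw) Rw)) as R1.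
  pose proof (represents_incr_1 _ _ _ _ (Rlt_le _ _ (proj1 Hr))
    (represents_prod _ _ _ _ _ _ _ (Rlt_le _ _ (proj1 Hr)) Rw RL)) as R2.
  (* Both sides of the integrated equation have the same coefficients: index 0 gives zero on both
     sides, and index [S n] is the recurrence [Hrec]. *)
  apply (represents_ext _ _ _ (PS_scal (a2 * gamma) (PS_minus (dilate gamma w) w))) in R2.
  - pose proof (represents_eq _ _ _ _ y (Rlt_le _ _ Hy) R1) as E1.
    pose proof (represents_eq _ _ _ _ y (Rlt_le _ _ Hy) R2) as E2.
    cbv beta in E1, E2; rewrite E1, <- E2; unfold I; ring.
  - intros [|n].
    + change (RtoC 0 = a2 * gamma * (1 * w 0%nat + - w 0%nat)); ring.
    + simpl PS_incr_1; rewrite <- Hrec.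
      change (a2 * gamma * (gamma ^ S n - 1) * w (S n)
              = a2 * gamma * (gamma ^ S n * w (S n) + - w (S n))); ring. }
assert (Z0 : Cmod 0 = 0%R) by apply Cmod_0.
exists g, (primitive w); split; [|split; [reflexivity|split; [|split]]].
- apply locally_origin; exists r; split; [lra|]; intros z Hz; apply (proj2 Rg); lra.
- apply pseries_sum_unique; exact (is_pseries_0 (primitive w)).
- rewrite Hg' by lra; rewrite <- Hw0; apply pseries_sum_unique; exact (is_pseries_0 w).
- apply locally_origin; exists r; split; [lra|]; intros z Hz.
  pose proof (integrated_equation_derivative a2 gamma r (C_derive g) (C_derive (C_derive g)) I F z
    ltac:(lra) Hz) as D.
  specialize (E z Hz) as Ez.
  assert (D' : a2 * gamma * (gamma * C_derive (C_derive g) (gamma * z) - C_derive (C_derive g) z)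
               = C_derive (C_derive g) z * I z + C_derive g z * F z).
  { apply D; [| |exact E].
    - intros y Hy; pose proof (represents_is_derive _ _ _ _ y Hy Rw) as H.
      rewrite (is_C_derive_unique _ _ _ H); exact H.
    - exact (is_derive_primitive r _ _ Fc I F z Hz RI RF). }
  unfold auxiliary_equation; cbv zeta.
  unfold F, rhs_fun in D'.
  set (u := C_derive g (gamma * z)) in *; set (v := C_derive g z) in *.
  set (X := C_derive (C_derive g) (gamma * z)) in *; set (Y := C_derive (C_derive g) z) in *.
  (* Multiplying the differentiated identity by [v = g' z] produces [v * I z], which the integrated
     equation [Ez] eliminates; the two terms [a2 gamma Y v] then cancel. *)
  transitivity (v * (a2 * gamma * (gamma * X - Y)) + a2 * gamma * Y * v); [ring|].
  rewrite D', Cmult_plus_distr_l.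
  replace (v * (Y * I z)) with (Y * (v * I z)) by ring.
  rewrite <- Ez; ring.
Qed.
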